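(* Let $\lambda K_{U,j}-H_{U,j}$ be the block upper Hessenberg pencil described in the context, with blocks $\Xi_{i,k}(\lambda)$ ($i\le k$) and subdiagonal blocks $\Gamma_i(\lambda-\sigma_{i-1})$ in block position $(i,i-1)$. Assume that $\Gamma_i$ is invertible for $i=2,\dots,j$, and let $P^{[k]}(\lambda)$ be the matrix polynomials defined recursively by $P^{[1]}(\lambda)=\Xi_{1,1}(\lambda)$ and, for $2\le k\le j$, $$P^{[k]}(\lambda)=\Xi_{1,k}(\lambda)\prod_{t=1}^{k-1}(\lambda-\sigma_t)-\sum_{i=1}^{k-1}P^{[i]}(\lambda)\Gamma_{i+1}^{-1}\Xi_{i+1,k}(\lambda)\prod_{t=i+1}^{k-1}(\lambda-\sigma_t).$$ Then the pencil $\lambda K_{U,j}-H_{U,j}$ is such that: (1) Every eigenvalue $\theta$ of the matrix polynomial $P^{[j]}(\lambda)$ is an eigenvalue of the pencil with the same multiplicity. (2) If $v=[\times,\dots,\times,v_j^*]^*$ and $w=[w_1^*,\times,\dots,\times]^*$ are right and left eigenvectors of the pencil corresponding to the eigenvalue $\theta$ (so $v_j\in\mathbb C^s$ is the last block of $v$ and $w_1\in\mathbb C^s$ is the first block of $w$), then $v_j$ and $w_1$ are right and left eigenvectors of $P^{[j]}(\lambda)$ corresponding to $\theta$, and $$w_1^*(P^{[j]})'(\theta)v_j=w^*K_{U,j}v.$$ (3) $P^{[j]}(\lambda)$ is a block characteristic polynomial of $H_{U,j}K_{U,j}^{-1}$ with respect to $E_1$. (4) The leading coefficient of $P^{[j]}(\lambda)$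 is $(E_j^TK_{U,j}^{-1}E_1)^{-1}$.
   Context: Let $A\in\mathbb C^{n\times n}$, $B\in\mathbb C^{n\times s}$ with $s>1$, $j\ge1$, and let $\sigma_1,\dots,\sigma_{j-1}\in\mathbb C$ be finite shifts that are not eigenvalues of $A$. Put $E_i=e_i\otimes I_s\in\mathbb C^{js\times s}$, with $e_i$ the $i$th canonical basis vector. The block rational Arnoldi procedure with $A$, starting block vector $B$, poles $\sigma_1,\dots,\sigma_{j-1}$ and last pole at infinity is run without breakdown or deflation (every generated block has full rank $s$); it gives a matrix with orthonormal columns $\mathbf U_{j+1}=[U_1,\dots,U_{j+1}]$, $U_i\in\mathbb C^{n\times s}$, with $B=U_1R_B$, $R_B\in\mathbb C^{s\times s}$, and block upper Hessenberg $(j+1)s\times js$ matrices $\underline H_{U,j},\underline K_{U,j}$ with $s\times s$ blocks satisfying $A\mathbf U_{j+1}\underline K_{U,j}=\mathbf U_{j+1}\underline H_{U,j}$, where the last block row of $\underline K_{U,j}$ is zero. $H_{U,j},K_{U,j}$ denote the top $js\times js$ parts; $K_{U,j}$ is invertible. The poles are encoded in the subdiagonal blocks: for $i=2,\dots,j$ the $(i,i-1)$ block of $\lambda K_{U,j}-H_{U,j}$ has the form $\Gamma_i(\lambda-\sigma_{i-1})$ with $\Gamma_i\in\mathbb C^{s\times s}$, and for $i\le k$ the $(i,k)$ block is denoted $\Xi_{i,k}(\lambda)$ (a matrix polynomial of degree at most 1): $$\lambda K_{U,j}-H_{U,j}=\begin{bmatrix}\Xi_{1,1}(\lambda)&\Xi_{1,2}(\lambda)&\cdots&\Xi_{1,j}(\lambda)\\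 \Gamma_2(\lambda-\sigma_1)&\Xi_{2,2}(\lambda)&\cdots&\Xi_{2,j}(\lambda)\\ &\ddots&\ddots&\vdots\\ &&\Gamma_j(\lambda-\sigma_{j-1})&\Xi_{j,j}(\lambda)\end{bmatrix}.$$ Standing assumption: no $\sigma_i$ is an eigenvalue of $H_{U,j}K_{U,j}^{-1}$ (which equals $\mathbf U_j^*A\mathbf U_j$ for $\mathbf U_j=[U_1,\dots,U_j]$). Eigenvalues of a matrix polynomial or pencil $P(\lambda)$ are the roots of $\det P(\lambda)$, with their multiplicity; right and left eigenvectors for $\theta$ are nonzero $v,w$ with $P(\theta)v=0$, $w^*P(\theta)=0$. A block characteristic polynomial of $N\in\mathbb C^{js\times js}$ with respect to $W\in\mathbb C^{js\times s}$ is an $s\times s$ matrix polynomial $P(\lambda)=\sum_{i=0}^j\lambda^iP_i$ of degree $j$ such that $P(N)\circ W:=\sum_{i=0}^jN^iWP_i=0$.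
   Formalization: In item (2) the printed identity is false in general; it is corrected to $w_1^*(P^{[j]})'(\theta)v_j=\prod_{t=1}^{j-1}(\theta-\sigma_t)\,w^*K_{U,j}v$, which agrees with the printed one when $j=1$ or the product equals 1. *)

(* Defs.v *)
From mathcomp Require Export all_boot all_order all_algebra.
From mathcomp Require Export sesquilinear spectral complex reals.

Export GRing.Theory Num.Theory.

#[export] Set Implicit Arguments.
#[export] Unset Strict Implicit.
#[export] Unset Printing Implicit Defensive.

#[global] Open Scope ring_scope.
#[global] Open Scope sesquilinear_scope.

(* Matrix polynomials are matrices with entries in {poly F}; unlike
   {poly 'M_s}, this covers matrices of every (also non-square) size. *)
Section MatrixPolynomials.
Variable F : fieldType.
Implicit Type s : nat.

Definition mxpoly_eval m n (x : F) (P : 'M[{poly F}]_(m, n)) : 'M[F]_(m, n) :=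
  map_mx (fun p : {poly F} => p.[x]) P.

Definition mxpoly_coef m n (P : 'M[{poly F}]_(m, n)) (i : nat) : 'M[F]_(m, n) :=
  map_mx (fun p : {poly F} => p`_i) P.

Definition mxpoly_deriv m n (P : 'M[{poly F}]_(m, n)) : 'M[{poly F}]_(m, n) :=
  map_mx (fun p : {poly F} => p^`()) P.

(* One plus the degree in the indeterminate, and 0 for the zero matrix, as for
   [size] on {poly F}. *)
Definition mxpoly_size m n (P : 'M[{poly F}]_(m, n)) : nat :=
  \max_(i < m) \max_(k < n) size (P i k).

Definition mxpoly_lead_coef m n (P : 'M[{poly F}]_(m, n)) : 'M[F]_(m, n) :=
  mxpoly_coef P (mxpoly_size P).-1.

Definition mxpoly_eigenvalue s (P : 'M[{poly F}]_s) (x : F) : bool :=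
  root (\det P) x.

Definition mxpoly_multiplicity s (P : 'M[{poly F}]_s) (x : F) : nat :=
  mup x (\det P).

Definition pencil m n (K H : 'M[F]_(m, n)) : 'M[{poly F}]_(m, n) :=
  'X *: map_mx polyC K - map_mx polyC H.

Definition block_char_poly d q s (N : 'M[F]_q) (W : 'M[F]_(q, s))
    (P : 'M[{poly F}]_s) : Prop :=
  mxpoly_size P = d.+1 /\ \sum_(i < d.+1) N ^+ i *m W *m mxpoly_coef P i = 0.

End MatrixPolynomials.

Section Eigenvectors.
Variable C : numClosedFieldType.

Definition right_eigenvector s (P : 'M[{poly C}]_s) (x : C) (v : 'cV[C]_s)
    : Prop :=
  v != 0 /\ mxpoly_eval x P *m v = 0.

Definition left_eigenvector s (P : 'M[{poly C}]_s) (x : C) (w : 'cV[C]_s)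
    : Prop :=
  w != 0 /\ w ^t* *m mxpoly_eval x P = 0.

End Eigenvectors.

(* Matrices made of s x s blocks have sizes written \sum_(i < j) s, so that the
   library's block operations apply. Blocks are numbered from 0. Since j >= 1,
   we write j = m.+1, where m is the number of finite poles: sigma t, for
   t : 'I_m, is the (t+1)-st pole, and Gamma t is the factor in the subdiagonal
   block in 0-based position (t.+1, t). *)
Section BlockHessenberg.
Variable F : fieldType.

Definition block_unit (j s : nat) (i : 'I_j) : 'M[F]_(\sum_(k < j) s, s) :=
  \mxcol_(k < j) ((k == i)%:R%:M : 'M[F]_s).

Definition top_part (j s : nat)
    (M : 'M[F]_(\sum_(i < j.+1) s, \sum_(k < j) s)) :
    'M[F]_(\sum_(i < j) s, \sum_(k < j) s) :=
  \mxblock_(i < j, k < j) submxblock M (widen_ord (leqnSn j) i) k.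

Definition block_upper_hessenberg (j s : nat)
    (M : 'M[F]_(\sum_(i < j.+1) s, \sum_(k < j) s)) : Prop :=
  forall (i : 'I_j.+1) (k : 'I_j), (k.+1 < i)%N -> submxblock M i k = 0.

(* The recursion that determines the P^[k], k = 1, ..., j (here P (k-1)), from
   the blocks of a block upper Hessenberg matrix polynomial L. *)
Definition hessenberg_recursion (m s : nat)
    (L : 'M[{poly F}]_(\sum_(i < m.+1) s, \sum_(k < m.+1) s))
    (sigma : 'I_m -> F) (Gamma : 'I_m -> 'M[F]_s)
    (P : 'I_m.+1 -> 'M[{poly F}]_s) : Prop :=
  forall k : 'I_m.+1,
    P k =
      (\prod_(t < m | (t < k)%N) ('X - (sigma t)%:P)) *: submxblock L ord0 k
      - \sum_(i < m | (i < k)%N)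
          (\prod_(t < m | (i < t < k)%N) ('X - (sigma t)%:P)) *:
            (P (widen_ord (leqnSn m) i) *m map_mx polyC (invmx (Gamma i))
               *m submxblock L (lift ord0 i) k).

End BlockHessenberg.

(* Eliminating the first block row of x K - H with the subdiagonal blocks leaves
   only its last block, P^[j](x) / pole_product sigma x. Hence
   w_1^* (P^[j])'(theta) v_j = pole_product sigma theta * w^* K v, and not just
   w^* K v, for eigenvectors v, w of the pencil. *)
Definition pole_product (F : fieldType) (m : nat) (sigma : 'I_m -> F) (x : F) : F :=
  \prod_(t < m) (x - sigma t).

(* The data produced by m.+1 steps of the block rational Arnoldi procedure
   without breakdown or deflation, with finite poles sigma and last pole at
   infinity: U = [U_1, ..., U_{m+2}], and Hu, Ku are the underlined
   (block rectangular) Hessenberg matrices. *)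
Record block_rational_arnoldi (C : numClosedFieldType) (n s m : nat)
    (A : 'M[C]_n) (B : 'M[C]_(n, s)) (sigma : 'I_m -> C)
    (U : 'M[C]_(n, \sum_(i < m.+2) s)) (RB : 'M[C]_s)
    (Hu Ku : 'M[C]_(\sum_(i < m.+2) s, \sum_(k < m.+1) s))
    (Gamma : 'I_m -> 'M[C]_s) : Prop := BlockRationalArnoldi {
  bra_orthonormal : U ^t* *m U = 1%:M;
  bra_start : B = submxrow U ord0 *m RB;
  bra_start_full : RB \in unitmx;
  bra_decomposition : A *m U *m Ku = U *m Hu;
  bra_H_hessenberg : block_upper_hessenberg Hu;
  bra_K_hessenberg : block_upper_hessenberg Ku;
  bra_K_last : forall k : 'I_m.+1, submxblock Ku ord_max k = 0;
  bra_H_last_full : submxblock Hu ord_max ord_max \in unitmx;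
  bra_K_unit : top_part Ku \in unitmx;
  bra_poles : forall t : 'I_m,
    submxblock (pencil (top_part Ku) (top_part Hu))
               (lift ord0 t) (widen_ord (leqnSn m) t)
    = ('X - (sigma t)%:P) *: map_mx polyC (Gamma t)
}.

(* Main.v *)
Require Import Defs.
From mathcomp Require Import zify.

(** Write L = X K - H for the pencil, E_0, ..., E_m for the block unit columns,
and pi for the product of all the factors X - sigma_t. Everything follows from
two polynomial identities that eliminate L from the left and from the right,
    R L = P_m E_m^T   and   L C = E_0 P_m,
where R is a block row whose first block is pi I, and C is a block column whose
last block is pi I.

The blocks of R are pi I followed by - pi_(t+1) P_t Gamma_t^-1, where pi_(t+1)
is the product of the X - sigma_u with u > t. Multiplying the recursion for P_k
by the poles from k on says precisely that the k-th block of R L vanishes for k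
< m, the block P_k having been cancelled by the subdiagonal block (X - sigma_k)
Gamma_k, and that the last block is P_m ([elimination_rowE]). The blocks of C
are obtained by solving block rows m, ..., 1 of L C = 0 upwards from C_m = pi
I. Each C_k turns out to be a multiple of the product of the poles before k, so
that no division by a pole is left, and it has degree at most m. Then L C = E_0
Q for some Q, and R L C = pi P_m = pi Q identifies Q with P_m
([elimination_colE]).

(1) Replace the first block row of the identity by R to get T, of determinant
pi^s. In T L the first block row is P_m E_m^T; moving it to the bottom makes
the matrix block upper triangular, with diagonal blocks (X - sigma_t) Gamma_t
and P_m. The powers of pi cancel, and det L is a nonzero constant times det P_m
([det_hessenberg]).

(2) An eigenvalue theta of L is an eigenvalue of H K^-1, hence not a pole, so
the subdiagonal blocks of L(theta) are invertible. A right kernel vector is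
therefore determined by its last block and a left one by its first block.
Evaluating R L = P_m E_m^T at theta gives P_m(theta) v_m = 0. The row w_0^*
R(theta) has the same first block as pi(theta) w^*, and both are annihilated by
the first m block columns of L(theta), so they are equal; this gives w_0^*
P_m(theta) = 0. Now differentiate the identity: in w_0^* (R' L + R K) v = w_0^*
P_m' v_m the first term vanishes at theta and the second is pi(theta) w^* K v
([eigenvector_deriv]).

(3) and (4) Let N = H K^-1. The coefficient of X^l in L C = E_0 P_m reads E_0
p_l = K c_(l-1) - N (K c_l), so the sum of the N^l E_0 p_l telescopes, and it
vanishes because C has degree at most m ([block_horner_eq0]). For l = m+1 the
equation is E_0 p_(m+1) = K c_m; since the last block of C is the monic pi I,
multiplying by E_m^T K^-1 gives (E_m^T K^-1 E_0) p_(m+1) = I. In particular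
p_(m+1) is invertible, so the degree of P_m is exactly m+1. *)

(** * Block products and block triangular determinants *)

Section BlockProducts.
Variables (R : pzSemiRingType) (p q : nat).
Variables (p_ : 'I_p -> nat) (q_ : 'I_q -> nat).

Lemma submxcol_mulmx n (A : 'M[R]_(\sum_i p_ i, \sum_k q_ k))
    (X : 'M[R]_(\sum_k q_ k, n)) i :
  submxcol (A *m X) i = \sum_k submxblock A i k *m submxcol X k.
Proof.
by rewrite -{1}[A]submxblockK -{1}[X]submxcolK mul_mxblock_mxrow mxcolK.
Qed.

Lemma submxrow_mulmx n (X : 'M[R]_(n, \sum_i p_ i))
    (A : 'M[R]_(\sum_i p_ i, \sum_k q_ k)) k :
  submxrow (X *m A) k = \sum_i submxrow X i *m submxblock A i k.
Proof.
by rewrite -{1}[A]submxblockK -{1}[X]submxrowK mul_mxrow_mxblock mxrowK.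
Qed.

Lemma mulmx_submx m n (X : 'M[R]_(m, \sum_i p_ i))
    (Y : 'M[R]_(\sum_i p_ i, n)) :
  X *m Y = \sum_i submxrow X i *m submxcol Y i.
Proof. by rewrite -{1}[X]submxrowK -{1}[Y]submxcolK mul_mxrow_mxcol. Qed.

End BlockProducts.

Section BlockDeterminants.
Variable R : comNzRingType.

Lemma det_castmx n n' (e : n = n') (A : 'M[R]_n) :
  \det (castmx (e, e) A) = \det A.
Proof. by case: _ / e; rewrite castmx_id. Qed.

Lemma det_mxblock_utrig n (p_ : 'I_n -> nat)
    (B : forall i k, 'M[R]_(p_ i, p_ k)) :
  (forall i k : 'I_n, (k < i)%N -> B i k = 0) ->
  \det (\mxblock_(i, k) B i k) = \prod_i \det (B i i).
Proof.
elim: n p_ B => [|n IHn] p_ B B0.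
  move: (\mxblock_(i, k) B i k); rewrite !big_ord0 => M.
  by rewrite det_mx00.
rewrite mxblock_recul det_castmx (_ : \mxcol_i _ = 0).
  rewrite det_ublock IHn ?big_ord_recl // => i k lt_ki.
  by apply: B0; rewrite !lift0.
apply/mxcolP=> i; rewrite mxcolK submxcol0; apply: B0.
by rewrite lift0.
Qed.

Lemma det_block_utrig n (p_ : 'I_n -> nat) (M : 'M[R]_(\sum_i p_ i)) :
  (forall i k : 'I_n, (k < i)%N -> submxblock M i k = 0) ->
  \det M = \prod_i \det (submxblock M i i).
Proof. by move=> M0; rewrite -{1}[M]submxblockK det_mxblock_utrig. Qed.

End BlockDeterminants.

(** * Block unit vectors and block permutations *)

Section BlockVectors.
Variable R : pzSemiRingType.
Variables (n s : nat).

Definition block_col t (i : 'I_n) (Q : 'M[R]_(s, t)) :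
  'M[R]_(\sum_(k < n) s, t) := \mxcol_k (if k == i then Q else 0).

Definition block_row t (i : 'I_n) (Q : 'M[R]_(t, s)) :
  'M[R]_(t, \sum_(k < n) s) := \mxrow_k (if k == i then Q else 0).

Lemma mulmx_block_col t u (X : 'M[R]_(u, \sum_(k < n) s)) (i : 'I_n)
    (Q : 'M[R]_(s, t)) :
  X *m block_col i Q = submxrow X i *m Q.
Proof.
rewrite mulmx_submx (bigD1 i) //= mxcolK eqxx big1 ?addr0 // => k /negPf ne_ki.
by rewrite mxcolK ne_ki mulmx0.
Qed.

Lemma mulmx_block_row t u (i : 'I_n) (Q : 'M[R]_(t, s))
    (Y : 'M[R]_(\sum_(k < n) s, u)) :
  block_row i Q *m Y = Q *m submxcol Y i.
Proof.
rewrite mulmx_submx (bigD1 i) //= mxrowK eqxx big1 ?addr0 // => k /negPf ne_ki.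
by rewrite mxrowK ne_ki mul0mx.
Qed.

Lemma block_colM t u (i : 'I_n) (P : 'M[R]_(s, t)) (Q : 'M[R]_(t, u)) :
  block_col i P *m Q = block_col i (P *m Q).
Proof.
by rewrite mxcol_mul; apply/eq_mxcol => k; case: eqP; rewrite ?mul0mx.
Qed.

End BlockVectors.

Definition block_perm (R : pzSemiRingType) n s (f : 'I_n -> 'I_n) :
    'M[R]_(\sum_(i < n) s) :=
  \mxcol_(i < n) (block_row (f i) 1%:M : 'M[R]_(s, \sum_(k < n) s)).

Lemma block_perm_mul (R : pzSemiRingType) n s u (f : 'I_n -> 'I_n)
    (X : 'M[R]_(\sum_(k < n) s, u)) :
  block_perm R s f *m X = \mxcol_i submxcol X (f i).
Proof.
by rewrite mxcol_mul; apply/eq_mxcol => i; rewrite mulmx_block_row mul1mx.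
Qed.

Lemma block_perm_unit (R : comUnitRingType) n s (f : 'I_n -> 'I_n) :
  injective f -> block_perm R s f \in unitmx.
Proof.
move=> f_inj; have [g fK gK] := injF_bij f_inj.
have: block_perm R s f *m block_perm R s g = 1%:M.
  rewrite block_perm_mul -mxdiagZ /mxdiag mxblockEv; apply/eq_mxcol => i.
  rewrite mxcolK fK; apply/eq_mxrow => k.
  by rewrite eq_sym conform_mx_id.
by case/mulmx1_unit.
Qed.

Lemma map_block_col (R R' : pzSemiRingType) (f : R -> R') n s t (i : 'I_n)
    (Q : 'M[R]_(s, t)) :
  f 0 = 0 -> map_mx f (block_col i Q) = block_col i (map_mx f Q).
Proof.
by move=> f0; apply/matrixP => a b; rewrite !mxE; case: eqP => _; rewrite !mxE.
Qed.

Lemma map_block_row (R R' : pzSemiRingType) (f : R -> R') n s t (i : 'I_n)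
    (Q : 'M[R]_(t, s)) :
  f 0 = 0 -> map_mx f (block_row i Q) = block_row i (map_mx f Q).
Proof.
by move=> f0; apply/matrixP => a b; rewrite !mxE; case: eqP => _; rewrite !mxE.
Qed.

Lemma block_unit_col (F : fieldType) n s (i : 'I_n) :
  block_unit F s i = block_col i 1%:M.
Proof. by apply/eq_mxcol => k; case: eqP => // _; rewrite raddf0. Qed.

Lemma tr_block_unit (F : fieldType) n s (i : 'I_n) :
  (block_unit F s i)^T = block_row i 1%:M.
Proof.
rewrite block_unit_col tr_mxcol; apply/eq_mxrow => k.
by case: eqP; rewrite ?trmx1 ?trmx0.
Qed.

(** * Matrix polynomials *)

Section MatrixPolynomialTheory.
Variable F : fieldType.

Lemma mxpoly_evalM m n p x (P : 'M[{poly F}]_(m, n)) (Q : 'M_(n, p)) :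
  mxpoly_eval x (P *m Q) = mxpoly_eval x P *m mxpoly_eval x Q.
Proof. exact: (map_mxM (horner_eval x)). Qed.

Lemma mxpoly_evalZ m n x (a : {poly F}) (P : 'M[{poly F}]_(m, n)) :
  mxpoly_eval x (a *: P) = a.[x] *: mxpoly_eval x P.
Proof. exact: (map_mxZ (horner_eval x)). Qed.

Lemma mxpoly_evalC m n x (M : 'M[F]_(m, n)) :
  mxpoly_eval x (map_mx polyC M) = M.
Proof. by apply/matrixP => i k; rewrite !mxE hornerC. Qed.

Lemma mxpoly_eval_pencil m n (K H : 'M[F]_(m, n)) x :
  mxpoly_eval x (pencil K H) = x *: K - H.
Proof. by apply/matrixP => i k; rewrite !mxE !hornerE. Qed.

Lemma mxpoly_eval_block_row n s t x (i : 'I_n) (Q : 'M[{poly F}]_(t, s)) :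
  mxpoly_eval x (block_row i Q) = block_row i (mxpoly_eval x Q).
Proof. by apply: map_block_row; rewrite horner0. Qed.

Lemma mxpoly_derivM m n p (P : 'M[{poly F}]_(m, n)) (Q : 'M_(n, p)) :
  mxpoly_deriv (P *m Q) = mxpoly_deriv P *m Q + P *m mxpoly_deriv Q.
Proof.
apply/matrixP => i k; rewrite !mxE raddf_sum -big_split; apply: eq_bigr => l _.
by rewrite !mxE /= derivM.
Qed.

Lemma mxpoly_deriv_pencil m n (K H : 'M[F]_(m, n)) :
  mxpoly_deriv (pencil K H) = map_mx polyC K.
Proof.
by apply/matrixP => i k; rewrite !mxE !derivE mul1r mulr0 addr0 subr0.
Qed.

Lemma mxpoly_deriv_block_row n s t (i : 'I_n) (Q : 'M[{poly F}]_(t, s)) :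
  mxpoly_deriv (block_row i Q) = block_row i (mxpoly_deriv Q).
Proof. by apply: map_block_row; rewrite deriv0. Qed.

Lemma mxpoly_coef_constM m n p (M : 'M[F]_(m, n)) (Q : 'M[{poly F}]_(n, p)) l :
  mxpoly_coef (map_mx polyC M *m Q) l = M *m mxpoly_coef Q l.
Proof.
apply/matrixP => i k; rewrite !mxE coef_sum; apply: eq_bigr => a _.
by rewrite !mxE coefCM.
Qed.

Lemma mxpoly_coef_pencilM m n p (K H : 'M[F]_(m, n))
    (Q : 'M[{poly F}]_(n, p)) l :
  mxpoly_coef (pencil K H *m Q) l =
  (if l is l'.+1 then K *m mxpoly_coef Q l' else 0) - H *m mxpoly_coef Q l.
Proof.
rewrite mulmxBl -scalemxAl -mxpoly_coef_constM.
apply/matrixP => i k; rewrite !mxE coefB mulrC coefMX.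
by case: l => [|l]; rewrite -?mxpoly_coef_constM !mxE.
Qed.

Lemma mxpoly_size_leP m n (P : 'M[{poly F}]_(m, n)) d :
  reflect (forall l, (d <= l)%N -> mxpoly_coef P l = 0) (mxpoly_size P <= d)%N.
Proof.
apply: (iffP idP) => [|P0].
  move=> /bigmax_leqP szP l le_dl; apply/matrixP => i k; rewrite !mxE.
  apply: nth_default; apply: leq_trans le_dl.
  by move: (szP i isT) => /bigmax_leqP; apply.
apply/bigmax_leqP => i _; apply/bigmax_leqP => k _.
by apply/leq_sizeP => l /P0/matrixP/(_ i k); rewrite !mxE.
Qed.

Lemma mxpoly_size_entry m n (P : 'M[{poly F}]_(m, n)) d :
  (mxpoly_size P <= d)%N <-> forall i k, (size (P i k) <= d)%N.
Proof.
split=> [/bigmax_leqP szP i k | szP].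
  by move: (szP i isT) => /bigmax_leqP; apply.
by apply/bigmax_leqP => i _; apply/bigmax_leqP.
Qed.

Lemma mxpoly_size_mul m n p (P : 'M[{poly F}]_(m, n)) (Q : 'M_(n, p)) a b :
  (mxpoly_size P <= a.+1)%N -> (mxpoly_size Q <= b.+1)%N ->
  (mxpoly_size (P *m Q) <= (a + b).+1)%N.
Proof.
move=> /mxpoly_size_entry szP /mxpoly_size_entry szQ.
apply/mxpoly_size_entry => i k; rewrite mxE (leq_trans (size_sum _ _ _)) //.
apply/bigmax_leqP => l _; rewrite (leq_trans (size_polyMleq _ _)) //.
rewrite -subn1 leq_subLR add1n -addSn -addnS.
by apply: leq_add; [apply: szP | apply: szQ].
Qed.

Lemma mxpoly_sizeN m n (P : 'M[{poly F}]_(m, n)) :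
  mxpoly_size (- P) = mxpoly_size P.
Proof.
by apply: eq_bigr => i _; apply: eq_bigr => k _; rewrite mxE size_polyN.
Qed.

Lemma mxpoly_size_sum (I : finType) (A : pred I) m n
    (P : I -> 'M[{poly F}]_(m, n)) d :
  (forall i, A i -> (mxpoly_size (P i) <= d)%N) ->
  (mxpoly_size (\sum_(i | A i) P i) <= d)%N.
Proof.
move=> szP; apply/mxpoly_size_entry => i k.
rewrite summxE (leq_trans (size_sum _ _ _)) //.
by apply/bigmax_leqP => l /szP/mxpoly_size_entry.
Qed.

Lemma mxpoly_size_submxblock p q (p_ : 'I_p -> nat) (q_ : 'I_q -> nat)
    (P : 'M[{poly F}]_(\sum_i p_ i, \sum_k q_ k)) i k d :
  (mxpoly_size P <= d)%N -> (mxpoly_size (submxblock P i k) <= d)%N.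
Proof.
by move=> /mxpoly_size_entry szP; apply/mxpoly_size_entry => a b; rewrite mxE.
Qed.

Lemma mxpoly_size_mxcol p n (p_ : 'I_p -> nat)
    (P : forall i, 'M[{poly F}]_(p_ i, n)) d :
  (forall i, (mxpoly_size (P i) <= d)%N) -> (mxpoly_size (\mxcol_i P i) <= d)%N.
Proof.
move=> szP; apply/mxpoly_size_entry => a b; rewrite mxE.
by have /mxpoly_size_entry := szP (tagnat.sig1 a).
Qed.

Lemma mxpoly_sizeZ m n (a : {poly F}) (P : 'M[{poly F}]_(m, n)) d e :
  (size a <= d.+1)%N -> (mxpoly_size P <= e.+1)%N ->
  (mxpoly_size (a *: P) <= (d + e).+1)%N.
Proof.
move=> sza /mxpoly_size_entry szP; apply/mxpoly_size_entry => i k.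
rewrite mxE (leq_trans (size_polyMleq _ _)) //.
rewrite -subn1 leq_subLR add1n -addSn -addnS.
exact: leq_add.
Qed.

End MatrixPolynomialTheory.

(** * Partial products of the poles *)

Section PoleProducts.
Variables (F : fieldType) (m : nat) (sigma : 'I_m -> F).

Definition partial_poles (a b : nat) : {poly F} :=
  \prod_(t < m | (a <= t < b)%N) ('X - (sigma t)%:P).

Lemma partial_poles_id a : partial_poles a a = 1.
Proof. by rewrite /partial_poles big_pred0 // => t; lia. Qed.

Lemma partial_poles_step (t : 'I_m) : partial_poles t t.+1 = 'X - (sigma t)%:P.
Proof.
rewrite /partial_poles (bigD1 t) /=; last by lia.
rewrite big_pred0 ?mulr1 // => u; rewrite -(inj_eq val_inj) /=; lia.
Qed.

Lemma partial_poles_cat a b c : (a <= b <= c)%N ->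
  partial_poles a b * partial_poles b c = partial_poles a c.
Proof.
move=> /andP[le_ab le_bc]; rewrite /partial_poles.
rewrite [RHS](bigID (fun t : 'I_m => (t < b)%N)).
by congr (_ * _); apply: eq_bigl => t; lia.
Qed.

Lemma monic_partial_poles a b : partial_poles a b \is monic.
Proof. exact: monic_prod_XsubC. Qed.

Lemma size_partial_poles a b : (size (partial_poles a b) <= (b - a).+1)%N.
Proof.
have [le_ba | lt_ab] := leqP b a.
  by rewrite /partial_poles big_pred0 ?size_poly1 // => t; lia.
elim: b lt_ab => // b IHb; rewrite ltnS => le_ab.
have sz_ab : (size (partial_poles a b) <= (b - a).+1)%N.
  case: (ltngtP a b) le_ab => // [lt_ab|<-] _; first exact: IHb.
  by rewrite partial_poles_id size_poly1.
have sz_b : (size (partial_poles b b.+1) <= 2)%N.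
  have [lt_bm | le_mb] := ltnP b m.
    by rewrite (partial_poles_step (Ordinal lt_bm)) size_XsubC.
  rewrite /partial_poles big_pred0 ?size_poly1 // => t.
  by have := ltn_ord t; lia.
rewrite -(@partial_poles_cat a b b.+1) ?le_ab ?leqnSn //.
rewrite (leq_trans (size_polyMleq _ _)) // -subn1 leq_subLR add1n subSn //.
by rewrite -[_.+3]addn2 addSnnS -addSnnS leq_add.
Qed.

Lemma partial_poles_full :
  partial_poles 0 m = \prod_(t < m) ('X - (sigma t)%:P).
Proof. by apply: eq_bigl => t; rewrite ltn_ord. Qed.

Lemma coef_partial_poles_full : (partial_poles 0 m)`_m = 1.
Proof.
have /monicP := monic_partial_poles 0 m.
rewrite /lead_coef partial_poles_full size_prod_XsubC /=.
by rewrite /index_enum -enumT size_enum_ord.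
Qed.

Lemma horner_partial_poles_full x :
  (partial_poles 0 m).[x] = pole_product sigma x.
Proof.
rewrite partial_poles_full horner_prod; apply: eq_bigr => t _.
by rewrite !hornerE.
Qed.

End PoleProducts.

(** * Hessenberg matrices with invertible subdiagonal blocks *)

(** Iterating f reaches a fixed point because r rounds settle the r largest
indices, whatever the starting family. *)
Lemma descending_recursion n (T : Type) (y0 : T)
    (f : ('I_n -> T) -> 'I_n -> T) :
  (forall y z (k : 'I_n),
     (forall i : 'I_n, (k < i)%N -> y i = z i) -> f y k = f z k) ->
  exists y, forall k, y k = f y k.
Proof.
move=> f_ext; exists (iter n f (fun=> y0)) => k.
suff fix_above r (i : 'I_n) : (n <= i + r)%N ->
    iter r f (fun=> y0) i = f (iter r f (fun=> y0)) i.
  by apply: fix_above; apply: leq_addl.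
elim: r i => [|r IHr] i le_n; first by have := ltn_ord i; lia.
by apply: f_ext => l lt_il; apply: IHr; lia.
Qed.

Section HessenbergVectors.
Variables (F : fieldType) (m s : nat).
Notation wid := (widen_ord (leqnSn m)).

Lemma ord_max_or_widen (i : 'I_m.+1) : i = ord_max \/ exists t, i = wid t.
Proof.
have [lt_im | le_mi] := ltnP i m; [right | left].
  by exists (Ordinal lt_im); apply/val_inj.
by apply/val_inj/eqP; rewrite eqn_leq le_mi -ltnS ltn_ord.
Qed.

(** Block column t of x M = 0 expresses block t+1 of x through the earlier
ones, so the vanishing of the first block propagates to the right. Only the
first m block columns enter: x M may have a nonzero last block. *)
Lemma hessenberg_row_eq0 n (M : 'M[F]_(\sum_(i < m.+1) s, \sum_(k < m.+1) s))
    (x : 'M[F]_(n, \sum_(i < m.+1) s)) :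
  (forall i k : 'I_m.+1, (k.+1 < i)%N -> submxblock M i k = 0) ->
  (forall t, submxblock M (lift ord0 t) (wid t) \in unitmx) ->
  submxrow x ord0 = 0 ->
  (forall t, submxrow (x *m M) (wid t) = 0) -> x = 0.
Proof.
move=> M_hess M_sub x0 xM0; apply/mxrowP => i; rewrite submxrow0.
have [r] := ubnP (val i); elim: r i => // r IHr i.
have [t -> le_tr | -> _] := unliftP ord0 i; last exact: x0.
have := xM0 t; rewrite submxrow_mulmx.
rewrite (bigD1 (lift ord0 t)) //= big1 => [|l ne_l].
  rewrite addr0.
  move=> /(congr1 (mulmxr (invmx (submxblock M (lift ord0 t) (wid t))))).
  by rewrite /= mulmxK // mul0mx.
have [lt_tl | le_lt] := ltnP t.+1 l; first by rewrite M_hess ?mulmx0.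
have lt_l : (l < lift ord0 t)%N.
  by rewrite ltn_neqAle (inj_eq val_inj) ne_l lift0.
by rewrite IHr ?mul0mx //; apply: leq_trans lt_l _; rewrite -ltnS.
Qed.

(** The mirror image: block row t+1 of M v = 0 expresses block t of v through
the later ones, and the first block of M v is arbitrary. *)
Lemma hessenberg_col_eq0 n (M : 'M[F]_(\sum_(i < m.+1) s, \sum_(k < m.+1) s))
    (v : 'M[F]_(\sum_(i < m.+1) s, n)) :
  (forall i k : 'I_m.+1, (k.+1 < i)%N -> submxblock M i k = 0) ->
  (forall t, submxblock M (lift ord0 t) (wid t) \in unitmx) ->
  submxcol v ord_max = 0 ->
  (forall t, submxcol (M *m v) (lift ord0 t) = 0) -> v = 0.
Proof.
move=> M_hess M_sub v0 Mv0; apply/mxcolP => i; rewrite submxcol0.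
have [r] := ubnP (m - val i)%N; elim: r i => // r IHr i lt_ir.
have [-> // | [t def_i]] := ord_max_or_widen i; rewrite def_i in lt_ir *.
have := Mv0 t; rewrite submxcol_mulmx (bigD1 (wid t)) //= big1 => [|l ne_l].
  rewrite addr0.
  move=> /(congr1 (mulmx (invmx (submxblock M (lift ord0 t) (wid t))))).
  by rewrite mulKmx // mulmx0.
have [lt_lt | le_tl] := ltnP l t; first by rewrite M_hess ?mul0mx // lift0.
have lt_tl : (wid t < l)%N by rewrite ltn_neqAle (inj_eq val_inj) eq_sym ne_l.
by rewrite IHr ?mulmx0 //; move: lt_ir lt_tl (ltn_ord l) => /=; lia.
Qed.

End HessenbergVectors.

(** * Eliminating the pencil from the left and from the right *)

Section Elimination.
Variables (F : fieldType) (m s : nat) (sigma : 'I_m -> F).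
Variables (Gamma : 'I_m -> 'M[F]_s).
Variable L : 'M[{poly F}]_(\sum_(i < m.+1) s, \sum_(k < m.+1) s).
Notation wid := (widen_ord (leqnSn m)).
Notation poles := (partial_poles sigma).

Hypothesis L_hess : forall i k : 'I_m.+1, (k.+1 < i)%N -> submxblock L i k = 0.
Hypothesis L_sub : forall t : 'I_m, submxblock L (lift ord0 t) (wid t)
  = ('X - (sigma t)%:P) *: map_mx polyC (Gamma t).
Hypothesis Gamma_unit : forall t, Gamma t \in unitmx.

(** When det L is nonzero, this row is P_m E_m^T L^-1 over the fraction field:
the last block row of the inverse of L multiplied by P_m. *)
Definition elimination_row (P : 'I_m.+1 -> 'M[{poly F}]_s) :=
  \mxrow_(i < m.+1) if unlift ord0 i is Some t then
      - (poles t.+1 m *: (P (wid t) *m map_mx polyC (invmx (Gamma t))))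
    else (poles 0 m)%:M : 'M_s.

(** Block k of the product is the recursion for P_k multiplied by the remaining
poles k, ..., m-1, minus the contribution of the subdiagonal block in column k.
For k < m the two are equal; in the last column there is no such block. *)
Lemma elimination_rowE P : hessenberg_recursion L sigma Gamma P ->
  elimination_row P *m L = block_row ord_max (P ord_max).
Proof.
move=> defP; apply/mxrowP => k; rewrite submxrow_mulmx !mxrowK.
rewrite big_ord_recl mxrowK unlift_none mul_scalar_mx.
under eq_bigr => i _ do rewrite mxrowK liftK mulNmx -scalemxAl.
have scaled : poles k m *: P k = poles 0 m *: submxblock L ord0 k
    - \sum_(i < m | (i < k)%N) poles i.+1 m *: (P (wid i)
        *m map_mx polyC (invmx (Gamma i)) *m submxblock L (lift ord0 i) k).
  have le_km : (k <= m)%N by rewrite -ltnS.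
  rewrite [P k]defP scalerBr scalerA mulrC -/(poles 0 k).
  rewrite partial_poles_cat //; congr (_ - _).
  rewrite scaler_sumr; apply: eq_bigr => i lt_ik; rewrite scalerA mulrC.
  by rewrite -/(poles i.+1 k) partial_poles_cat ?lt_ik.
(* Terms i > k vanish by the Hessenberg form; i = k is the subdiagonal one. *)
rewrite sumrN (bigID (fun i : 'I_m => (i < k)%N)) /= opprD addrA -scaled.
have [-> | [t ->]] := ord_max_or_widen k.
  rewrite eqxx partial_poles_id scale1r big_pred0 ?subr0 // => i.
  by rewrite ltn_ord.
rewrite -(inj_eq val_inj) /= (ltn_eqF (ltn_ord t)) (bigD1 t) ?ltnn //=.
rewrite big1 => [|i /andP[le_ti ne_it]].
  rewrite addr0 L_sub -scalemxAr -mulmxA -map_mxM mulVmx //.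
  rewrite map_mx1 mulmx1 scalerA mulrC -partial_poles_step.
  by rewrite partial_poles_cat ?subrr // leqnSn ltn_ord.
rewrite L_hess ?mulmx0 ?scaler0 // lift0 /= ltnS.
by rewrite ltn_neqAle (inj_eq val_inj) eq_sym ne_it leqNgt.
Qed.

(** Block row t+1 of L C = 0, written for C_k = pi_(0,k) Y_k, where pi_(0,k) is
the product of the poles before k: the factor pi_(0,t+1) is then common to all
the terms, and dividing it out leaves Y_t a polynomial. *)
Lemma elimination_col_exists : exists Y : 'I_m.+1 -> 'M[{poly F}]_s,
  Y ord_max = 1%:M /\
  forall t, Y (wid t) = - (map_mx polyC (invmx (Gamma t)) *m
    \sum_(k < m.+1 | (t < k)%N)
      poles t.+1 k *: (submxblock L (lift ord0 t) k *m Y k)).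
Proof.
pose f (Y : 'I_m.+1 -> 'M[{poly F}]_s) (i : 'I_m.+1) :=
  if unlift ord_max i is Some t then - (map_mx polyC (invmx (Gamma t)) *m
    \sum_(k < m.+1 | (t < k)%N)
      poles t.+1 k *: (submxblock L (lift ord0 t) k *m Y k))
  else 1%:M.
have widE t : wid t = lift ord_max t.
  by apply: val_inj; rewrite /= /bump leqNgt ltn_ord.
have [|Y defY] := @descending_recursion m.+1 'M[{poly F}]_s 0 f.
  move=> Y Z i eqYZ; rewrite /f; case: unliftP => // t def_i.
  congr (- (_ *m _)); apply: eq_bigr => k lt_tk; rewrite eqYZ //.
  by rewrite def_i -widE.
exists Y; split=> [|t]; first by rewrite defY /f unlift_none.
by rewrite defY /f widE liftK.
Qed.

(** The first block Q of L C is a polynomial matrix that nothing relates to P_m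
a priori; comparing the two ways of computing R L C shows pi Q = pi P_m. The
degree bound holds because Y_k has degree at most m - k. *)
Lemma elimination_colE P : hessenberg_recursion L sigma Gamma P ->
  (mxpoly_size L <= 2)%N ->
  exists C : 'M[{poly F}]_(\sum_(k < m.+1) s, s),
  [/\ L *m C = block_col ord0 (P ord_max),
      submxcol C ord_max = (poles 0 m)%:M &
      (mxpoly_size C <= m.+1)%N].
Proof.
move=> defP szL; have [Y [Ymax defY]] := elimination_col_exists.
pose C := \mxcol_k (poles 0 k *: Y k); exists C.
have Cmax : submxcol C ord_max = (poles 0 m)%:M.
  by rewrite mxcolK Ymax scalemx1.
have LC t : submxcol (L *m C) (lift ord0 t) = 0.
  rewrite submxcol_mulmx (bigID (fun k : 'I_m.+1 => (t < k)%N)) /= addrC.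
  rewrite (bigD1 (wid t)) /= ?ltnn // big1; last first.
    move=> k /andP[le_kt ne_kt]; rewrite L_hess ?mul0mx // lift0 ltnS.
    rewrite -[t : nat]/(wid t : nat) ltn_neqAle (inj_eq val_inj).
    by rewrite ne_kt leqNgt.
  rewrite addr0 L_sub mxcolK /= defY -scalemxAl -scalemxAr mulmxN mulmxA.
  rewrite -map_mxM mulmxV // map_mx1 mul1mx scalerA scalerN mulrC.
  rewrite -partial_poles_step partial_poles_cat ?leqnSn // addrC.
  apply/eqP; rewrite subr_eq0 scaler_sumr; apply/eqP/eq_bigr => k lt_tk.
  by rewrite mxcolK -scalemxAr scalerA partial_poles_cat.
split=> //.
  have defLC : L *m C = block_col ord0 (submxcol (L *m C) ord0).
    apply/mxcolP => i; rewrite mxcolK.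
    by have [t -> | ->] := unliftP ord0 i; rewrite ?eqxx ?LC.
  rewrite defLC; congr block_col.
  have poles_neq0 : poles 0 m != 0 by rewrite monic_neq0 ?monic_partial_poles.
  have: elimination_row P *m (L *m C) = poles 0 m *: P ord_max.
    by rewrite mulmxA elimination_rowE // mulmx_block_row Cmax mul_mx_scalar.
  rewrite {1}defLC mulmx_block_col mxrowK unlift_none mul_scalar_mx.
  move: (submxcol _ _) (P _) => Q1 Q2 /matrixP eq_poles.
  apply/matrixP => i k; apply: (mulfI poles_neq0).
  by have := eq_poles i k; rewrite !mxE.
have szY (k : 'I_m.+1) : (mxpoly_size (Y k) <= (m - k).+1)%N.
  have [r] := ubnP (m - k)%N; elim: r k => // r IHr k.
  have [-> _ | [t -> le_r]] := ord_max_or_widen k.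
    rewrite Ymax subnn; apply/mxpoly_size_entry => i j; rewrite mxE.
    by case: eqP => _; rewrite ?size_poly1 ?size_poly0.
  rewrite defY.
  rewrite mxpoly_sizeN -[(m - _)%N]add0n; apply: mxpoly_size_mul.
    apply/mxpoly_size_entry => i j; rewrite !mxE.
    exact: size_polyC_leq1.
  apply: mxpoly_size_sum => k' lt_tk.
  have szLk := mxpoly_size_submxblock (lift ord0 t) k' szL.
  have szLY := mxpoly_size_mul szLk (IHr k' _).
  have def_exp : (m - t = (k' - t.+1) + (1 + (m - k')))%N.
    by have := ltn_ord k'; move: lt_tk; lia.
  rewrite /= def_exp; apply: mxpoly_sizeZ; first exact: size_partial_poles.
  by apply: szLY; move: le_r lt_tk (ltn_ord k') => /=; lia.
apply: mxpoly_size_mxcol => k.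
have def_exp : (m = (k - 0) + (m - k))%N by have := ltn_ord k; lia.
rewrite [X in (_ <= X.+1)%N]def_exp; apply: mxpoly_sizeZ (szY k).
exact: size_partial_poles.
Qed.

End Elimination.

(** * The determinant *)

Section PencilDeterminant.
Variables (F : fieldType) (m s : nat) (sigma : 'I_m -> F).
Variables (Gamma : 'I_m -> 'M[F]_s).
Variable L : 'M[{poly F}]_(\sum_(i < m.+1) s, \sum_(k < m.+1) s).
Notation wid := (widen_ord (leqnSn m)).
Notation poles := (partial_poles sigma).

Hypothesis L_hess : forall i k : 'I_m.+1, (k.+1 < i)%N -> submxblock L i k = 0.
Hypothesis L_sub : forall t : 'I_m, submxblock L (lift ord0 t) (wid t)
  = ('X - (sigma t)%:P) *: map_mx polyC (Gamma t).
Hypothesis Gamma_unit : forall t, Gamma t \in unitmx.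

(** T replaces the first block row of L by R L = P_m E_m^T, and the cyclic
block permutation S moves it to the bottom, making S T L block upper
triangular. *)
Lemma det_hessenberg P : hessenberg_recursion L sigma Gamma P ->
  exists2 c : F, c != 0 & \det L = c *: \det (P ord_max).
Proof.
move=> defP; pose R := elimination_row sigma Gamma P.
pose T : 'M[{poly F}]_(\sum_(i < m.+1) s) :=
  \mxcol_(i < m.+1)
    (if i == ord0 then R else block_row i 1%:M : 'M_(s, \sum_(k < m.+1) s)).
pose S := block_perm {poly F} s (@ordS m.+1).
have detT : \det T = poles 0 m ^+ s.
  rewrite det_block_utrig => [|i k lt_ki].
    rewrite big_ord_recl big1 => [|i _]; rewrite submxblockEv !mxcolK.
      by rewrite mxrowK unlift_none det_scalar mulr1.
    by rewrite mxrowK eqxx det1.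
  rewrite submxblockEv mxcolK; case: eqP lt_ki => [-> //|_ lt_ki].
  by rewrite mxrowK -(inj_eq val_inj) (ltn_eqF lt_ki).
have STL_row (i : 'I_m.+1) : submxcol (S *m (T *m L)) i =
    if ordS i == ord0 then block_row ord_max (P ord_max)
    else submxcol L (ordS i).
  rewrite block_perm_mul mxcolK mxcol_mul mxcolK.
  by case: eqP => _; rewrite ?elimination_rowE // mulmx_block_row mul1mx.
have ordS_max : ordS (ord_max : 'I_m.+1) = ord0.
  by apply: val_inj; rewrite /= modnn.
have ordS_wid t : ordS (wid t) = lift ord0 t.
  by apply: val_inj; rewrite /= modn_small // ltnS.
have detSTL : \det (S *m (T *m L)) =
    poles 0 m ^+ s * (\prod_t \det (Gamma t))%:P * \det (P ord_max).
  rewrite det_block_utrig => [|i k lt_ki].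
    rewrite big_ord_recr /= submxblockEv STL_row ordS_max eqxx mxrowK eqxx.
    congr (_ * _); rewrite partial_poles_full -prodrXl rmorph_prod -big_split.
    apply: eq_bigr => t _; rewrite submxblockEv STL_row ordS_wid /=.
    by rewrite -submxblockEv L_sub detZ det_map_mx.
  rewrite submxblockEv STL_row; have [def_i | [t def_i]] := ord_max_or_widen i.
    rewrite def_i in lt_ki *; rewrite ordS_max eqxx mxrowK.
    by rewrite -(inj_eq val_inj) (ltn_eqF lt_ki).
  rewrite def_i in lt_ki *.
  by rewrite ordS_wid -submxblockEv L_hess // lift0 ltnS.
have: \det S \in GRing.unit.
  by rewrite -unitmxE block_perm_unit //; exact: ordS_inj.
(* A unit of the polynomial ring is a constant. *)
rewrite poly_unitE => /andP[/eqP sz_detS]; rewrite unitfE => detS0.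
have Gamma0 : \prod_t \det (Gamma t) != 0.
  by apply/prodf_neq0 => t _; rewrite -unitfE -unitmxE.
exists (((\det S)`_0)^-1 * \prod_t \det (Gamma t)).
  by rewrite mulf_neq0 ?invr_neq0.
have poles_neq0 : poles 0 m ^+ s != 0.
  by rewrite expf_neq0 ?monic_neq0 ?monic_partial_poles.
move: detSTL; rewrite !det_mulmx detT mulrCA -mulrA => /(mulfI poles_neq0).
rewrite {1}[\det S]size1_polyC ?sz_detS // !mul_polyC -scalerA => <-.
by rewrite scalerK.
Qed.

End PencilDeterminant.

(** * Eigenvectors *)

Section PencilEigenvectors.
Variables (F : fieldType) (m s : nat) (sigma : 'I_m -> F).
Variables (Gamma : 'I_m -> 'M[F]_s).
Variables K H : 'M[F]_(\sum_(i < m.+1) s, \sum_(k < m.+1) s).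
Notation wid := (widen_ord (leqnSn m)).
Notation poles := (partial_poles sigma).
Notation L := (pencil K H).

Hypothesis L_hess : forall i k : 'I_m.+1, (k.+1 < i)%N -> submxblock L i k = 0.
Hypothesis L_sub : forall t : 'I_m, submxblock L (lift ord0 t) (wid t)
  = ('X - (sigma t)%:P) *: map_mx polyC (Gamma t).
Hypothesis Gamma_unit : forall t, Gamma t \in unitmx.

Variable P : 'I_m.+1 -> 'M[{poly F}]_s.
Hypothesis defP : hessenberg_recursion L sigma Gamma P.
Variable theta : F.
Hypothesis theta_not_pole : forall t, theta != sigma t.

Let Lth := mxpoly_eval theta L.
Let R := elimination_row sigma Gamma P.

Lemma eval_hess (i k : 'I_m.+1) : (k.+1 < i)%N -> submxblock Lth i k = 0.
Proof.
move=> lt_ki; rewrite -[LHS]/(mxsub _ _ (map_mx _ _)) -map_mxsub.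
rewrite -[mxsub _ _ _]/(submxblock L i k) L_hess //.
exact: (map_mx0 (horner_eval theta)).
Qed.

Lemma eval_sub t : submxblock Lth (lift ord0 t) (wid t) \in unitmx.
Proof.
rewrite -[submxblock _ _ _]/(mxsub _ _ (map_mx _ _)) -map_mxsub.
rewrite -[mxsub _ _ _]/(submxblock L (lift ord0 t) (wid t)) L_sub.
rewrite -[map_mx _ _]/(mxpoly_eval _ _) mxpoly_evalZ mxpoly_evalC.
by rewrite unitmxZ // !hornerE unitfE subr_eq0.
Qed.

Lemma eval_elimination_row :
  mxpoly_eval theta R *m Lth
  = block_row ord_max (mxpoly_eval theta (P ord_max)).
Proof. by rewrite -mxpoly_evalM elimination_rowE // mxpoly_eval_block_row. Qed.

Lemma right_kernel_block n (v : 'M[F]_(_, n)) : v != 0 -> Lth *m v = 0 ->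
  submxcol v ord_max != 0 /\
  mxpoly_eval theta (P ord_max) *m submxcol v ord_max = 0.
Proof.
move=> v0 Lv0; split; last first.
  by rewrite -mulmx_block_row -eval_elimination_row -mulmxA Lv0 mulmx0.
apply: contra_neq v0 => vmax0.
apply: hessenberg_col_eq0 eval_hess eval_sub vmax0 _.
by move=> t; rewrite Lv0 submxcol0.
Qed.

(** The last equation recovers y from its first block: both sides have the same
first block, and their difference is annihilated by all block columns of
L(theta) but the last. *)
Lemma left_kernel_block n (y : 'M[F]_(n, _)) : y != 0 -> y *m Lth = 0 ->
  [/\ submxrow y ord0 != 0,
      submxrow y ord0 *m mxpoly_eval theta (P ord_max) = 0 &
      submxrow y ord0 *m mxpoly_eval theta R = pole_product sigma theta *: y].
Proof.
move=> y0 yL0.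
have yR :
    submxrow y ord0 *m mxpoly_eval theta R = pole_product sigma theta *: y.
  apply/eqP; rewrite -subr_eq0; apply/eqP.
  apply: hessenberg_row_eq0 eval_hess eval_sub _ _ => [|t].
    rewrite submxrowB -mul_submxrow.
    have -> :
        submxrow (mxpoly_eval theta R) ord0 = (pole_product sigma theta)%:M.
      rewrite -[submxrow _ _]/(mxsub _ _ (map_mx _ _)) -map_mxsub.
      rewrite -[mxsub _ _ _]/(submxrow R ord0) mxrowK unlift_none.
      rewrite -horner_partial_poles_full.
      exact: (map_scalar_mx (horner_eval theta)).
    by rewrite mul_mx_scalar; apply/matrixP => a b; rewrite !mxE subrr.
  rewrite mulmxBl -scalemxAl yL0 scaler0 subr0 -mulmxA eval_elimination_row.
  rewrite -mul_submxrow mxrowK.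
  by rewrite -(inj_eq val_inj) /= (ltn_eqF (ltn_ord t)) mulmx0.
split=> //.
  apply: contra_neq y0 => y0.
  apply: hessenberg_row_eq0 eval_hess eval_sub y0 _ => t.
  by rewrite yL0 submxrow0.
have: submxrow y ord0 *m (mxpoly_eval theta R *m Lth) = 0.
  by rewrite mulmxA yR -scalemxAl yL0 scaler0.
move=> /(congr1 (fun M => submxrow M ord_max)).
by rewrite eval_elimination_row -mul_submxrow mxrowK eqxx submxrow0.
Qed.

(** Differentiate R L = P_m E_m^T at theta between y_0 and v: the term with R'
vanishes because L(theta) v = 0, and y_0 R(theta) is pi(theta) y. *)
Lemma eigenvector_deriv n p (y : 'M[F]_(n, _)) (v : 'M[F]_(_, p)) :
  y != 0 -> y *m Lth = 0 -> Lth *m v = 0 ->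
  submxrow y ord0 *m mxpoly_eval theta (mxpoly_deriv (P ord_max))
    *m submxcol v ord_max
  = pole_product sigma theta *: (y *m K *m v).
Proof.
move=> y0 yL0 Lv0; have [_ _ yR] := left_kernel_block y0 yL0.
have /(congr1 (fun M => mxpoly_eval theta (mxpoly_deriv M))) :=
  elimination_rowE L_hess L_sub Gamma_unit defP.
rewrite mxpoly_derivM mxpoly_deriv_pencil mxpoly_deriv_block_row.
rewrite mxpoly_eval_block_row.
move=> /(congr1 (fun M => submxrow y ord0 *m M *m v)) dR.
rewrite -mulmxA -mulmx_block_row mulmxA -{}dR.
rewrite -[mxpoly_eval _ (_ + _)]/(map_mx (horner_eval theta) _) map_mxD.
rewrite -!/(mxpoly_eval _ _) !mxpoly_evalM mxpoly_evalC.
rewrite mulmxDr mulmxDl -!mulmxA Lv0 !mulmx0 add0r.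
by rewrite mulmxA yR -scalemxAl.
Qed.

End PencilEigenvectors.

(** * The block characteristic polynomial *)

Section BlockCharacteristic.
Variables (F : fieldType) (d q s : nat) (K H : 'M[F]_q).
Variables (W : 'M[F]_(q, s)) (C : 'M[{poly F}]_(q, s)) (P : 'M[{poly F}]_s).

Hypothesis K_unit : K \in unitmx.
(* With N = H K^-1 this says (X - N) (K C) = W P, that is, W P is divisible on
   the left by X - N; the remainder of that division is the value of P at N with
   W inserted, which therefore vanishes. *)
Hypothesis LC : pencil K H *m C = map_mx polyC W *m P.
Hypothesis szC : (mxpoly_size C <= d.+1)%N.

Let N := H *m invmx K.

Lemma coef_pencil_column l : W *m mxpoly_coef P l =
  (if l is l'.+1 then K *m mxpoly_coef C l' else 0)
  - N *m (K *m mxpoly_coef C l).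
Proof.
by rewrite -mxpoly_coef_constM -LC mxpoly_coef_pencilM mulmxA mulmxKV.
Qed.

(** The l-th term of the sum is N^l D_(l-1) - N^(l+1) D_l with D_l = K c_l. *)
Lemma block_horner_telescope r :
  \sum_(i < r.+1) N ^+ i *m W *m mxpoly_coef P i
  = - (N ^+ r.+1 *m (K *m mxpoly_coef C r)).
Proof.
elim: r => [|r IHr].
  by rewrite big_ord1 -mulmxA coef_pencil_column sub0r mulmxN mul1mx.
rewrite big_ord_recr IHr /= -[_ *m W *m _]mulmxA coef_pencil_column mulmxBr.
by rewrite addKr [N ^+ r.+2]exprSr -[_ * N]/(_ *m N) -[_ *m N *m _]mulmxA.
Qed.

Lemma block_horner_eq0 : \sum_(i < d.+2) N ^+ i *m W *m mxpoly_coef P i = 0.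
Proof.
rewrite block_horner_telescope (mxpoly_size_leP _ _ szC) //.
by rewrite !mulmx0 oppr0.
Qed.

Lemma mulmx_lead_coef : W *m mxpoly_coef P d.+1 = K *m mxpoly_coef C d.
Proof.
by rewrite coef_pencil_column (mxpoly_size_leP _ _ szC d.+1) // !mulmx0 subr0.
Qed.

Lemma mulmx_high_coef l : (d.+1 < l)%N -> W *m mxpoly_coef P l = 0.
Proof.
case: l => // l lt_dl; rewrite coef_pencil_column.
by rewrite !(mxpoly_size_leP _ _ szC) ?(ltnW lt_dl) // !mulmx0 subr0.
Qed.

End BlockCharacteristic.

Theorem theorem4p2 (R : realType) (n s m : nat)
    (A : 'M[R[i]]_n) (B : 'M[R[i]]_(n, s)) (sigma : 'I_m -> R[i])
    (U : 'M[R[i]]_(n, \sum_(i < m.+2) s)) (RB : 'M[R[i]]_s)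
    (Hu Ku : 'M[R[i]]_(\sum_(i < m.+2) s, \sum_(k < m.+1) s))
    (Gamma : 'I_m -> 'M[R[i]]_s)
    (H := top_part Hu) (K := top_part Ku)
    (P : 'I_m.+1 -> 'M[{poly R[i]}]_s) :
  (1 < s)%N ->
  (forall t, ~~ eigenvalue A (sigma t)) ->
  block_rational_arnoldi A B sigma U RB Hu Ku Gamma ->
  (forall t, ~~ eigenvalue (H *m invmx K) (sigma t)) ->
  (forall t, Gamma t \in unitmx) ->
  hessenberg_recursion (pencil K H) sigma Gamma P ->
  [/\ (forall theta : R[i],
         mxpoly_eigenvalue (P ord_max) theta ->
         mxpoly_eigenvalue (pencil K H) theta /\
         mxpoly_multiplicity (pencil K H) theta
         = mxpoly_multiplicity (P ord_max) theta),
      (forall (theta : R[i]) (v w : 'cV[R[i]]_(\sum_(k < m.+1) s))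
              (vj := submxcol v ord_max) (w1 := submxcol w ord0),
         right_eigenvector (pencil K H) theta v ->
         left_eigenvector (pencil K H) theta w ->
         [/\ right_eigenvector (P ord_max) theta vj,
             left_eigenvector (P ord_max) theta w1 &
             w1 ^t* *m mxpoly_eval theta (mxpoly_deriv (P ord_max)) *m vj
             = pole_product sigma theta *: (w ^t* *m K *m v)]),
      block_char_poly m.+1 (H *m invmx K) (block_unit _ s ord0) (P ord_max) &
      (block_unit _ s ord_max)^T *m invmx K *m block_unit _ s ord0 \in unitmx /\
      mxpoly_lead_coef (P ord_max)
      = invmx ((block_unit _ s ord_max)^T *m invmx K *m block_unit _ s ord0)].
Proof.
move=> s_gt1 _ arnoldi no_pole Gamma_unit defP.
have K_unit : K \in unitmx := bra_K_unit arnoldi.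
have L_sub := bra_poles arnoldi.
have L_hess (i k : 'I_m.+1) : (k.+1 < i)%N -> submxblock (pencil K H) i k = 0.
  move=> lt_ki; have top0 M : block_upper_hessenberg M ->
      submxblock (top_part M) i k = 0 :> 'M[R[i]]_s.
    by move=> M_hess; rewrite mxblockK M_hess.
  move/matrixP: (top0 _ (bra_K_hessenberg arnoldi)) => K0.
  move/matrixP: (top0 _ (bra_H_hessenberg arnoldi)) => H0.
  apply/matrixP => a b; have := K0 a b; have := H0 a b; rewrite !mxE => -> ->.
  by rewrite polyC0 mulr0 subr0.
have szL : (mxpoly_size (pencil K H) <= 2)%N.
  apply/mxpoly_size_leP => -[|[|l]] // _; apply/matrixP => a b.
  by rewrite !mxE coefB mulrC coefMX !coefC subr0.
have [C [LC Cmax szC]] := elimination_colE L_hess L_sub Gamma_unit defP szL.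
have [c c_neq0 detL] := det_hessenberg L_hess L_sub Gamma_unit defP.
have LCunit : pencil K H *m C = map_mx polyC (block_unit _ s ord0) *m P ord_max.
  by rewrite LC block_unit_col map_block_col // map_mx1 block_colM mul1mx.
have lead : (block_unit _ s ord_max)^T *m invmx K *m block_unit _ s ord0
    *m mxpoly_coef (P ord_max) m.+1 = 1%:M.
  rewrite -mulmxA (mulmx_lead_coef K_unit LCunit szC) -mulmxA mulKmx //.
  rewrite tr_block_unit mulmx_block_row mul1mx.
  have /matrixP CmaxE := Cmax; apply/matrixP => a b.
  have := congr1 (fun p : {poly R[i]} => p`_m) (CmaxE a b).
  rewrite !mxE coefMn coef_partial_poles_full => ->.
  by [].
have [Eunit Punit] := mulmx1_unit lead.
have sizeP : mxpoly_size (P ord_max) = m.+2.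
  apply/eqP; rewrite eqn_leq; apply/andP; split.
    apply/mxpoly_size_leP => l lt_ml.
    have := mulmx_high_coef K_unit LCunit szC lt_ml.
    rewrite block_unit_col block_colM mul1mx.
    move=> /(congr1 (fun M => submxcol M ord0)).
    by rewrite mxcolK eqxx submxcol0.
  rewrite ltnNge; apply/negP => /mxpoly_size_leP /(_ m.+1 (leqnn _)) coef0.
  pose i0 := Ordinal (ltnW s_gt1).
  move: lead; rewrite coef0 mulmx0 => /matrixP /(_ i0 i0).
  by rewrite !mxE eqxx => /eqP; rewrite eq_sym oner_eq0.
split.
- move=> theta; rewrite /mxpoly_eigenvalue /mxpoly_multiplicity detL => P_theta.
  split; first by rewrite rootZ.
  by rewrite -mul_polyC mupMr // rootC.
- move=> theta v w vj w1 [v0 Lv0] [w0 wL0].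
  have w0' : w ^t* != 0 by rewrite map_mx_eq0 trmx_eq0.
  (* w^* (theta K - H) = 0 makes w^* a left eigenvector of H K^-1. *)
  have theta_not_pole t : theta != sigma t.
    apply: contraNneq (no_pole t) => <-.
    apply/eigenvalueP; exists (w ^t*) => //.
    move: wL0; rewrite mxpoly_eval_pencil mulmxBr => /eqP; rewrite subr_eq0.
    by rewrite mulmxA => /eqP <-; rewrite -scalemxAr -scalemxAl mulmxK.
  have w1E : submxrow (w ^t*) ord0 = w1 ^t*.
    by apply/matrixP => a b; rewrite !mxE.
  have [vj0 Pvj0] := right_kernel_block L_hess L_sub Gamma_unit defP
    theta_not_pole v0 Lv0.
  have [w10 w1P0 _] := left_kernel_block L_hess L_sub Gamma_unit defP
    theta_not_pole w0' wL0.
  split; [by [] | split | ].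
  + by move: w10; rewrite w1E map_mx_eq0 trmx_eq0.
  + by rewrite -w1E.
  rewrite -w1E; exact: (eigenvector_deriv L_hess L_sub Gamma_unit defP
    theta_not_pole w0' wL0 Lv0).
- split=> //; exact: block_horner_eq0 K_unit LCunit szC.
split=> //; rewrite /mxpoly_lead_coef sizeP /=.
by rewrite -[LHS](mulKmx Eunit) lead mulmx1.
Qed.
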